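(* Let $q>0$ and $p\geqslant 0$ be integers, and let $\mathcal M=\{M_1,\dots,M_p\}$ be a family of non-empty and proper subsets of $[q]$. Suppose that for every non-empty subset $I\subseteq[p]$ at least one of the following holds: $$\bigcup_{i\in I}M_i=[q],$$ or there exists $j\in I$ such that $$\bigcup_{i\in I}M_i\neq\bigcup_{i\in I\setminus\{j\}}M_i.$$ Then $p\leqslant 2q-2$.
   Context: For a non-negative integer $b$, $[b]$ denotes the set $\{1,2,\dots,b\}$ (so $[0]=\emptyset$). The family is indexed by $[p]$, and a union over the empty index set is the empty set. *)

(* Defs.v *)
(* The sets [q] = {1, ..., q} and [p] are rendered by the ordinal types 'I_q
   and 'I_p, which are numbered from 0. *)
From mathcomp Require Export all_boot.

Set Implicit Arguments.
Unset Strict Implicit.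
Unset Printing Implicit Defensive.

(* Main.v *)
(* Let [x] be an element of minimal degree, the degree of an element being the
   number of members of the family that contain it. The members avoiding [x]
   do not cover [q], so the hypothesis yields a [y] lying in exactly one of
   them (any [y != x] works if there are none). By minimality of the degree of
   [x], at most one member contains [x] but not [y]. Discard the at most two
   members separating [x] from [y]: in the remaining family [x] and [y] are
   twins, so [x] can be deleted from the ground set, and induction on [q]
   applies. *)
Require Import Defs.
From mathcomp Require Import all_boot.
From mathcomp Require Import zify.

Set Implicit Arguments.
Unset Strict Implicit.
Unset Printing Implicit Defensive.

Lemma card_setIdID (J : finType) (I : {set J}) (a b : pred J) :
  #|[set i in I | a i]| =
    #|[set i in I | a i && b i]| + #|[set i in I | a i && ~~ b i]|.
Proof.
rewrite -(cardsID [set i | b i] [set i in I | a i]).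
by congr (_ + _); apply: eq_card => i; rewrite !inE -?andbA // andbC -andbA.
Qed.

(** The members of [P] containing both [x] and [y] count equally in the two degrees, so minimality
    of the degree of [x] carries the bound on members with [y] but not [x] over to those with [x]
    but not [y]. *)
Lemma exists_weak_twins (T J : finType) (M : J -> {set T}) (X : {set T})
    (P : {set J}) :
  1 < #|X| ->
  (forall (I : {set J}) x, I \subset P -> I != set0 -> x \in X ->
     (forall i, i \in I -> x \notin M i) ->
     exists2 y, y \in X & #|[set i in I | y \in M i]| = 1) ->
  exists x y, [/\ x \in X, y \in X, x != y,
    #|[set i in P | (y \in M i) && (x \notin M i)]| <= 1 &
    #|[set i in P | (x \in M i) && (y \notin M i)]| <= 1].
Proof.
move=> X_gt1 privP.
have [x0 x0X] : exists x0, x0 \in X by apply/card_gt0P; apply: ltnW.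
pose deg x := #|[set i in P | x \in M i]|.
case: (@arg_minnP _ x0 (mem X) deg x0X) => x; rewrite inE => xX min_x.
have [y [yX xy yx1]] : exists y, [/\ y \in X, x != y &
    #|[set i in P | (y \in M i) && (x \notin M i)]| <= 1].
  have [F0|FN0] := eqVneq [set i in P | x \notin M i] set0.
    have /card_gt0P[y] : 0 < #|X :\ x| by rewrite (cardsD1 x) xX in X_gt1.
    rewrite !inE eq_sym => /andP[xy yX]; exists y; split => //.
    rewrite (_ : [set i in P | _] = set0) ?cards0 //; apply/setP => i.
    by move/setP: F0 => /(_ i); rewrite !inE andbCA => ->; rewrite andbF.
  have [| i |y yX Fy1] := privP _ x _ FN0 xX.
  - by apply/subsetP => i; rewrite inE => /andP[].
  - by rewrite inE => /andP[].
  exists y; split => //; last first.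
    rewrite -Fy1 subset_leq_card //; apply/subsetP => i.
    by rewrite !inE => /and3P[-> -> ->].
  (* No member avoiding [x] contains [x], so [y = x] would make the count 0 instead of 1. *)
  apply: contra_eq_neq Fy1 => <-.
  rewrite (_ : [set i in _ | _] = set0) ?cards0 //; apply/setP => i.
  by rewrite !inE -andbA andNb andbF.
exists x, y; split => //.
have := min_x y yX; rewrite /deg.
rewrite (card_setIdID P (fun i => x \in M i) (fun i => y \in M i)).
rewrite (card_setIdID P (fun i => y \in M i) (fun i => x \in M i)).
have -> : [set i in P | (y \in M i) && (x \in M i)] =
          [set i in P | (x \in M i) && (y \in M i)].
  by apply/setP => i; rewrite !inE [(y \in _) && _]andbC.
by rewrite leq_add2l => /leq_trans; apply.
Qed.

(** The ground set [X] and the index set [P] vary while [M] stays fixed: the induction shrinks both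
    and only sees the traces of the members on [X]. *)
Lemma card_family_bound (T J : finType) (M : J -> {set T}) (X : {set T})
    (P : {set J}) :
  (forall i, i \in P -> M i :&: X != set0) ->
  (forall i, i \in P -> ~~ (X \subset M i)) ->
  (forall (I : {set J}) x, I \subset P -> I != set0 -> x \in X ->
     (forall i, i \in I -> x \notin M i) ->
     exists2 y, y \in X & #|[set i in I | y \in M i]| = 1) ->
  #|P| <= 2 * #|X| - 2.
Proof.
have [n] := ubnP #|X|; elim: n => // n IHn in X P * => leXn meetP properP privP.
have [X_gt1|X_le1] := ltnP 1 #|X|; last first.
  (* A member meeting a ground set of at most one element contains all of it. *)
  suff -> : P = set0 by rewrite cards0.
  apply/setP => i; rewrite inE; apply/negP => iP.
  have /set0Pn[x /setIP[xM xX]] := meetP i iP.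
  have /negP := properP i iP; apply; apply/subsetP => z zX.
  by rewrite (card_le1_eqP X_le1 _ _ xX zX) in xM *.
have [x [y [xX yX xy yx1 xy1]]] := exists_weak_twins X_gt1 privP.
pose P' := [set i in P | (x \in M i) == (y \in M i)].
have P'P : P' \subset P by apply/subsetP => i; rewrite inE => /andP[].
have twin i : i \in P' -> (x \in M i) = (y \in M i).
  by rewrite inE => /andP[_ /eqP].
have yX' : y \in X :\ x by rewrite !inE eq_sym xy.
have leP : #|P| <= #|P'| + 2.
  have sub : P \subset P' :|: ([set i in P | (y \in M i) && (x \notin M i)]
                     :|: [set i in P | (x \in M i) && (y \notin M i)]).
    apply/subsetP => i iP; rewrite !inE iP.
    by case: (x \in M i); case: (y \in M i).
  apply: leq_trans (subset_leq_card sub) _.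
  apply: leq_trans (leq_card_setU _ _) _; rewrite leq_add2l.
  by apply: leq_trans (leq_card_setU _ _) _; rewrite (leq_add yx1 xy1).
have cardX : #|X| = #|X :\ x|.+1 by rewrite (cardsD1 x) xX.
(* Since [1 < #|X|], the set [X :\ x] is nonempty and the subtraction is not truncated. *)
suff : #|P'| <= 2 * #|X :\ x| - 2 by lia.
apply: IHn => [|i iP'|i iP'|I w IP' IN0 wX' wI]; first by lia.
- have /set0Pn[z /setIP[zM zX]] := meetP i (subsetP P'P i iP').
  apply/set0Pn; have [zx|zx] := eqVneq z x.
    by exists y; rewrite inE yX' -twin // -zx zM.
  by exists z; rewrite !inE zM zx zX.
- apply: contra (properP i (subsetP P'P i iP')) => /subsetP sXM.
  apply/subsetP => z zX; have [->|zx] := eqVneq z x.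
    by rewrite twin // sXM.
  by apply: sXM; rewrite !inE zx zX.
- have wX : w \in X by case/setD1P: wX'.
  have [z zX z1] := privP I w (subset_trans IP' P'P) IN0 wX wI.
  (* If the element covered exactly once is the deleted [x], its twin [y] lies in the same members
     of [I] and replaces it. *)
  have [zx|zx] := eqVneq z x; last by exists z => //; rewrite !inE zx zX.
  exists y => //; rewrite -z1 zx; apply: eq_card => i; rewrite !inE.
  by have [iI|//] := boolP (i \in I); rewrite twin // (subsetP IP').
Qed.

Theorem lemma1 (q p : nat) (hq : 0 < q) (M : 'I_p -> {set 'I_q})
  (hne : forall i : 'I_p, M i != set0)
  (hproper : forall i : 'I_p, M i \proper [set: 'I_q])
  (hM : forall I : {set 'I_p}, I != set0 ->
     \bigcup_(i in I) M i = [set: 'I_q] \/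
     exists j : 'I_p, j \in I /\
       \bigcup_(i in I) M i <> \bigcup_(i in I :\ j) M i) :
  p <= 2 * q - 2.
Proof.
rewrite -{1}(card_ord p) -{1}(card_ord q) -!cardsT.
apply: (@card_family_bound _ _ M) => [i _|i _|I x _ IN0 _ xI].
- by rewrite setIT.
- by have := hproper i; rewrite properE => /andP[].
case: (hM I IN0) => [/setP/(_ x)|[j [jI neU]]].
  by rewrite inE => /bigcupP[i /xI /negP].
have sub : \bigcup_(i in I :\ j) M i \subset \bigcup_(i in I) M i.
  by apply/bigcupsP => i /setD1P[_ iI]; apply: bigcup_sup.
have /subsetPn[y /bigcupP[i iI yi] yN] :
    ~~ (\bigcup_(i in I) M i \subset \bigcup_(i in I :\ j) M i).
  by apply/negP => sub'; apply: neU; apply/eqP; rewrite eqEsubset sub' sub.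
(* The union loses [y] when [j] is removed, so [y] is covered by [M j] alone. *)
have only_j k : k \in I -> y \in M k -> k = j.
  move=> kI yk; apply/eqP; apply: contraNT yN => kj.
  by apply/bigcupP; exists k; rewrite // !inE kj.
exists y => //; apply/eqP/cards1P; exists j; apply/setP => k; rewrite !inE.
apply/andP/eqP => [[]|->]; first exact: only_j.
by rewrite -(only_j i).
Qed.
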